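(* Let $G$ be an AH-algebra (the directed group of an e-ring $(R,E)$) with set of projections $P$, let $g,h\in G$ and let $A\subseteq G$. Then: (i) $gCh$ if and only if every projection in the spectral resolution of $g$ commutes with every projection in the spectral resolution of $h$. (ii) $C(C(A)\cap P)=CC(A)$. (iii) $CPC(g)=CC(g)$.
   Context: **e-rings.** An e-ring is a pair $(R,E)$ where $R$ is an associative ring with unity $1\neq 0$ and $E\subseteq R$ is a subset (elements called effects) such that $0,1\in E$; $e\in E\Rightarrow 1-e\in E$; and the set $E^{+}$ of all finite sums $e_1+\cdots+e_n$ with $e_i\in E$ satisfies, for all $a,b\in E^{+}$: (i) $-a\in E^{+}\Rightarrow a=0$; (ii) $1-a\in E^{+}\Rightarrow a\in E$; (iii) $ab=ba\Rightarrow ab\in E^{+}$; (iv) $aba\in E^{+}$; (v) $aba=0\Rightarrow ab=ba=0$; (vi) $(a-b)^2\in E^{+}$. The directed group of $(R,E)$ is $G:=E^{+}-E^{+}=\{a-b: a,b\in E^{+}\}$, a subgroup of the additive group of $R$, partially ordered by $g\leq h\Leftrightarrow h-g\in E^{+}$. The set of projections is $P:=\{p\in G: p=p^2\}$. Products of elements of $G$ are taken in $R$. **Commutants.** For $g,h\in G$, $gCh$ means $gh=hg$. For $A\subseteq G$, $C(A):=\{g\in G: gCa\ \forall a\in A\}$, $CC(A):=C(C(A))$; $C(g):=C(\{g\})$, $CC(g):=CC(\{g\})$; $CPC(g):=C(P\cap C(g))$. **AH-algebra.** $G$ is an AH-algebra iff: (1) there is an effect $\frac12\in E$ with $\frac12+\frac12=1$;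 (2) quadratic annihilation (QA): for all $g,h\in G$, $gh^2g=0\Rightarrow gh=hg=0$; (3) commutative Vigier (CV) property: every ascending sequence $g_1\leq g_2\leq\cdots$ of pairwise commuting elements of $G$ that is bounded above in $G$ has a supremum $g$ in $G$, and $g\in CC(\{g_n:n\in\mathbb N\})$. An AH-algebra $G$ is always regarded as an archimedean partially ordered real vector space (it admits a compatible real vector space structure extending its ordered group structure, with $0\le\lambda$ and $0\le g$ implying $0\le\lambda g$; with the product $\frac12(gh+hg)$ it is a real Jordan algebra). **Notation in an AH-algebra.** For $0\leq g\in G$, $g^{1/2}$ is the unique element of $G$ with $0\leq g^{1/2}$ and $(g^{1/2})^2=g$ (it exists); $|g|:=(g^2)^{1/2}$ and $g^{+}:=\frac12(|g|+g)$ for any $g\in G$. The carrier projection $g^{\mathrm o}$ of $g\in G$ is the unique projection in $P$ such that for all $h\in G$, $gh=0\Leftrightarrow g^{\mathrm o}h=0$ (it exists). The spectral resolution of $g\in G$ is the family of projections $p_{g,\lambda}:=1-((g-\lambda\cdot 1)^{+})^{\mathrm o}\in P$, $\lambda\in\mathbb R$. *)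

(* Defs.v *)
From HB Require Import structures.
From mathcomp Require Import all_boot all_order all_algebra.
From mathcomp Require Import boolp classical_sets reals.

Set Implicit Arguments.
Unset Strict Implicit.
Unset Printing Implicit Defensive.

Import Order.TTheory GRing.Theory Num.Theory.
Local Open Scope classical_set_scope.
Local Open Scope ring_scope.

Section ERing.
Variable (R : nzRingType).
Implicit Types (E A : set R) (g h x : R).

(* The empty sum is allowed; since 0 is an effect this adds nothing. *)
Definition Eplus E : set R :=
  [set x | exists2 s : seq R, (forall e, e \in s -> E e) & x = \sum_(e <- s) e].

Record is_ering E : Prop := IsERing {
  ering_0 : E 0;
  ering_1 : E 1;
  ering_compl : forall e, E e -> E (1 - e);
  ering_proper : forall a, Eplus E a -> Eplus E (- a) -> a = 0;
  ering_unit_interval : forall a, Eplus E a -> Eplus E (1 - a) -> E a;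
  ering_comm_mul : forall a b, Eplus E a -> Eplus E b ->
    a * b = b * a -> Eplus E (a * b);
  ering_quad : forall a b, Eplus E a -> Eplus E b -> Eplus E (a * b * a);
  ering_quad0 : forall a b, Eplus E a -> Eplus E b ->
    a * b * a = 0 -> a * b = 0 /\ b * a = 0;
  ering_sqr : forall a b, Eplus E a -> Eplus E b -> Eplus E ((a - b) ^+ 2)
}.

Definition dgroup E : set R :=
  [set x | exists a b, [/\ Eplus E a, Eplus E b & x = a - b]].

Definition ele E g h : Prop := Eplus E (h - g).

Definition projections E : set R := [set p | dgroup E p /\ p = p ^+ 2].

Definition commutant E A : set R :=
  [set g | dgroup E g /\ forall a, A a -> GRing.comm g a].

Definition bicommutant E A : set R := commutant E (commutant E A).

Definition CPC E g : set R :=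
  commutant E (projections E `&` commutant E [set g]).

Definition is_supremum E (u : nat -> R) g : Prop :=
  [/\ dgroup E g, forall n, ele E (u n) g &
      forall b, dgroup E b -> (forall n, ele E (u n) b) -> ele E g b].

Definition has_half E : Prop := exists2 c, E c & c + c = 1.

Definition quadratic_annihilation E : Prop :=
  forall g h, dgroup E g -> dgroup E h ->
    g * h ^+ 2 * g = 0 -> g * h = 0 /\ h * g = 0.

Definition commutative_Vigier E : Prop :=
  forall u : nat -> R,
    (forall n, dgroup E (u n)) ->
    (forall n, ele E (u n) (u n.+1)) ->
    (forall m n, GRing.comm (u m) (u n)) ->
    (exists2 b, dgroup E b & forall n, ele E (u n) b) ->
    exists2 g, is_supremum E u g & bicommutant E (range u) g.

Record is_AH_algebra E : Prop := IsAHAlgebra {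
  AH_ering : is_ering E;
  AH_half : has_half E;
  AH_QA : quadratic_annihilation E;
  AH_CV : commutative_Vigier E
}.

(* The existence and uniqueness of the element selected by [xget] are theorems
   about AH-algebras; the default value 0 is never used there. *)
Definition esqrt E g : R :=
  xget 0 [set x | [/\ dgroup E x, ele E 0 x & x ^+ 2 = g]].

Definition eabs E g : R := esqrt E (g ^+ 2).

Definition carrier E g : R :=
  xget 0 [set p | projections E p /\
                  forall h, dgroup E h -> (g * h = 0 <-> p * h = 0)].

Section Scalars.
Variable (K : realType).
Implicit Types (s : K -> R -> R).

(* Scalar multiplication is only constrained on the directed group: the ring
   [R] itself need not be a vector space. *)
Record is_real_ordered_space E s : Prop := IsRealOrderedSpace {
  scal_closed : forall l g, dgroup E g -> dgroup E (s l g);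
  scalDr : forall l g h, dgroup E g -> dgroup E h ->
    s l (g + h) = s l g + s l h;
  scalDl : forall l m g, dgroup E g -> s (l + m) g = s l g + s m g;
  scalA : forall l m g, dgroup E g -> s l (s m g) = s (l * m) g;
  scal1 : forall g, dgroup E g -> s 1 g = g;
  scal_ge0 : forall l g, dgroup E g -> 0 <= l -> ele E 0 g -> ele E 0 (s l g)
}.

Definition epos E s g : R := s 2^-1 (eabs E g + g).

Definition spectral_proj E s g (l : K) : R :=
  1 - carrier E (epos E s (g - s l 1)).

End Scalars.
End ERing.

(* Main.v *)
(* The bicommutant of a commuting subset of G is closed under products, so it
   is a commutative subring of R contained in G, and the commutative Vigier
   property gives suprema inside it.  In such a commutative ordered ring one
   constructs square roots, carriers and hence the projections
   e_t = ((g - t)^+)^o, and shows that the lower Riemann sums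
   t_0 + d * sum_k e_{t_0 + k d} lie between g - d and g.  If x commutes with
   all e_t for t dyadic, it commutes with these sums; after a shift by a
   multiple of d = 2^-n they become an ascending sequence with supremum g, and
   the Vigier property says precisely that x then commutes with g.  All three
   parts follow from this and from e_t being in CC(g). *)
Require Import Defs.
From HB Require Import structures.
From mathcomp Require Import all_boot all_order all_algebra ring.
From mathcomp Require Import boolp classical_sets reals.

Set Implicit Arguments.
Unset Strict Implicit.
Unset Printing Implicit Defensive.

Import Order.TTheory GRing.Theory Num.Theory.
Local Open Scope classical_set_scope.
Local Open Scope ring_scope.

(** * Commutative rings with a positive cone and suprema of bounded ascending sequences *)

Section VigierCone.
Variables (S : comNzRingType) (P : set S) (c : S).

Definition cone_sup (u : nat -> S) g : Prop :=
  (forall n, P (g - u n)) /\ forall b, (forall n, P (b - u n)) -> P (b - g).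

(** The order is [x <= y] iff [P (y - x)], and [c] is one half. These properties pass from [G] to
    the bicommutant of a commuting set; powers of [c] act as small scalars. *)
Record vigier_cone : Prop := VigierCone {
  coneD : forall x y, P x -> P y -> P (x + y);
  coneM : forall x y, P x -> P y -> P (x * y);
  cone_sqr : forall x, P (x ^+ 2);
  cone_proper : forall x, P x -> P (- x) -> x = 0;
  cone_reduced : forall x : S, x ^+ 2 = 0 -> x = 0;
  cone_half : P c;
  cone_halfD : c + c = 1;
  cone_unit : forall x, exists n : nat, P (n%:R - x);
  cone_vigier : forall u : nat -> S, (forall n, P (u n.+1 - u n)) ->
    (exists b, forall n, P (b - u n)) -> exists g, cone_sup u g
}.

Hypothesis HP : vigier_cone.

Let PD := coneD HP.
Let PM := coneM HP.
Let Pc := cone_half HP.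
Let c2 := cone_halfD HP.

Lemma cone0 : P 0.
Proof. by rewrite -[0](expr0n S 2); apply: cone_sqr. Qed.

Lemma cone1 : P 1.
Proof. by rewrite -[1](expr1n S 2); apply: cone_sqr. Qed.

Lemma cone_nat n : P n%:R.
Proof. by elim: n => [|n IH]; rewrite ?mulrS; [apply: cone0|apply: PD => //; apply: cone1]. Qed.

Lemma cone_exp x n : P x -> P (x ^+ n).
Proof. by move=> Px; elim: n => [|n IH]; rewrite ?exprS; [apply: cone1|apply: PM]. Qed.

Lemma cone_anti x y : P (x - y) -> P (y - x) -> x = y.
Proof.
move=> h1 h2; apply/eqP; rewrite -subr_eq0; apply/eqP.
by apply: (cone_proper HP) => //; rewrite opprB.
Qed.

Lemma half_mul2 x : c * (x + x) = x.
Proof. by rewrite mulrDr -mulrDl c2 mul1r. Qed.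

Lemma half_exp2 n : c ^+ n * 2 ^+ n = 1 :> S.
Proof. by rewrite -exprMn mulrDr mulr1 c2 expr1n. Qed.

(** From [x <= n <= 2 ^ n] it follows that the exponent [n] itself works. *)
Lemma cone_scale x : exists k, P (1 - c ^+ k * x).
Proof.
have [n Pn] := cone_unit HP x; exists n.
have -> : 1 - c ^+ n * x = c ^+ n * ((2 ^ n - n)%:R + (n%:R - x)).
  have lt2n : (n <= 2 ^ n)%N by apply: ltnW; apply: ltn_expl.
  rewrite natrB // natrX -[X in X - _](half_exp2 n).
move: (c ^+ n) (2 ^+ n) => u v.  ring.
by apply: PM; [apply: cone_exp|apply: PD => //; apply: cone_nat].
Qed.

(** The supremum [v] of the sequence [- c ^+ n] is at most 0. As [c ^+ n] is twice [c ^+ n.+1],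
    [v + v] is again an upper bound, so [v >= 0]. Hence [v = 0], and [x] is an upper bound of the
    sequence. *)
Lemma cone_archimedean x : (forall n, P (x + c ^+ n)) -> P x.
Proof.
move=> xP.
have [|| v [v1 v2]] := @cone_vigier HP (fun n => - c ^+ n).
- move=> n; have -> : - c ^+ n.+1 - - c ^+ n = c ^+ n.+1.
    by rewrite exprS -{2}(half_mul2 (c ^+ n)); ring.
  exact: cone_exp.
- by exists 0 => n; rewrite opprK add0r; apply: cone_exp.
have vn : P (- v).
  by rewrite -sub0r; apply: v2 => n; rewrite opprK add0r; apply: cone_exp.
have vp : P v.
  have -> : v = v + v - v by ring.
  apply: v2 => n; have := v1 n.+1.
  have -> : v + v - - c ^+ n = (v - - c ^+ n.+1) + (v - - c ^+ n.+1).
    by rewrite exprS -{1}(half_mul2 (c ^+ n)); ring.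
  by move=> h; apply: PD.
have v0 : v = 0 by apply: cone_proper HP _ vp vn.
by rewrite -[x]subr0 -v0; apply: v2 => n; rewrite opprK.
Qed.

(* The square root is 1 - y where y is the supremum of the iterates of
   y |-> (1 - g + y^2) / 2 starting at 0. *)
Lemma cone_sqrt_unit g : P g -> P (1 - g) -> exists2 r, P r & r ^+ 2 = g.
Proof.
move=> Pg Pa; set a := 1 - g in Pa.
pose y := fix y n := if n is n.+1 then c * (a + y n ^+ 2) else 0.
have yS n : y n.+1 = c * (a + y n ^+ 2) by [].
have y0 n : P (y n).
  case: n => [|n]; first exact: cone0.
  by rewrite yS; apply: PM => //; apply: PD => //; apply: cone_sqr.
have y1 n : P (1 - y n).
  elim: n => [|n IH]; first by rewrite subr0; apply: cone1.
  have -> : 1 - y n.+1 = c * (1 - a) + c * ((1 - y n) * (1 + y n)).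
    by rewrite yS -[X in X - _]c2; ring.
  by rewrite subKr; apply: PD; apply: PM => //; apply: PM => //; apply: PD => //; apply: cone1.
have yle n : P (y n.+1 - y n).
  elim: n => [|n IH]; first by rewrite subr0.
  have -> : y n.+2 - y n.+1 = c * ((y n.+1 - y n) * (y n.+1 + y n)).
    by rewrite (yS n.+1) {2}(yS n); ring.
  by apply: PM => //; apply: PM => //; apply: PD.
have [|z [z1 z2]] := cone_vigier HP yle; first by exists 1.
have Pz : P z by have := z1 0; rewrite subr0.
have Pz1 : P (1 - z) by apply: z2.
(* Instead of passing to the limit in the recursion, each inequality comes from an upper bound of
   all [y n]: first [z + z - c * (a + z ^+ 2)], then [c * (a + z ^+ 2)]. *)
have zfix : z = c * (a + z ^+ 2).
  apply: cone_anti.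
    have -> : z - c * (a + z ^+ 2) = z + z - c * (a + z ^+ 2) - z by ring.
    apply: z2 => n.
    have -> : z + z - c * (a + z ^+ 2) - y n =
        (z - y n.+1) + (z - y n) * (c * (1 - z) + c * (1 - y n)).
      have -> : c * (1 - z) + c * (1 - y n) = 1 - c * (z + y n).
        by rewrite -[X in _ = X - _]c2; ring.
      by rewrite yS; ring.
    by apply: PD => //; apply: PM => //; apply: PD; apply: PM.
  apply: z2 => -[|n]; first by rewrite subr0; apply: PM => //; apply: PD => //; apply: cone_sqr.
  have -> : c * (a + z ^+ 2) - y n.+1 = c * ((z - y n) * (z + y n)).
    by rewrite yS; ring.
  by apply: PM => //; apply: PM => //; apply: PD.
exists (1 - z) => //.
have z2E : z + z = a + z ^+ 2 by rewrite {1 2}zfix -mulrDl c2 mul1r.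
have -> : (1 - z) ^+ 2 = 1 - (z + z) + z ^+ 2 by ring.
by rewrite z2E /a; ring.
Qed.

(** Scaling [g] below 1 by the square of [c ^+ k] reduces to the unit interval; the root is then
    multiplied by [2 ^+ k]. *)
Lemma cone_sqrt g : P g -> exists2 r, P r & r ^+ 2 = g.
Proof.
move=> Pg; have [k Pk] := cone_scale g.
have Pck : P (c ^+ k) by apply: cone_exp.
have [||r Pr rE] := @cone_sqrt_unit (c ^+ k * (c ^+ k * g)).
- by apply: PM => //; apply: PM.
- have -> : 1 - c ^+ k * (c ^+ k * g) =
      (c ^+ k * (1 - c ^+ k * g)) + c ^+ k * (2 ^ k - 1)%:R.
    by rewrite natrB ?expn_gt0 // natrX -{1}(half_exp2 k); ring.
  apply: PD; first by apply: PM.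
  by apply: PM => //; apply: cone_nat.
exists (2 ^+ k * r); first by apply: PM => //; rewrite -natrX; apply: cone_nat.
rewrite exprMn rE.
have -> : 2 ^+ k ^+ 2 * (c ^+ k * (c ^+ k * g)) = (c ^+ k * 2 ^+ k) ^+ 2 * g by ring.
by rewrite half_exp2 expr1n mul1r.
Qed.

(** The elements [(q - r) ^+ 2 * q] and [(q - r) ^+ 2 * r] are positive with sum 0, so both vanish.
    Then the fourth power of [q - r] is 0, and reducedness applies twice. *)
Lemma cone_sqrt_uniq q r : P q -> P r -> q ^+ 2 = r ^+ 2 -> q = r.
Proof.
move=> Pq Pr qr.
have e0 : (q - r) ^+ 2 * q + (q - r) ^+ 2 * r = 0.
  have -> : (q - r) ^+ 2 * q + (q - r) ^+ 2 * r = (q ^+ 2 - r ^+ 2) * (q - r) by ring.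
  by rewrite qr subrr mul0r.
have P1 : P ((q - r) ^+ 2 * q) by apply: PM => //; apply: cone_sqr.
have P2 : P ((q - r) ^+ 2 * r) by apply: PM => //; apply: cone_sqr.
have q0 : (q - r) ^+ 2 * q = 0.
  by apply: (cone_proper HP) => //; move/eqP: e0; rewrite addr_eq0 => /eqP ->; rewrite opprK.
have r0 : (q - r) ^+ 2 * r = 0 by rewrite q0 add0r in e0.
apply/eqP; rewrite -subr_eq0; apply/eqP.
do 2!apply: (cone_reduced HP).
have -> : (q - r) ^+ 2 ^+ 2 = ((q - r) ^+ 2 * q - (q - r) ^+ 2 * r) * (q - r) by ring.
by rewrite q0 r0 subrr mul0r.
Qed.


(* The carrier is the supremum of this sequence: as the powers (1 - b g^2)^(2^n)
   are obtained by repeated squaring, their infimum is idempotent. *)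
Definition carrier_seq (T : nzRingType) (b g : T) n : T :=
  1 - (1 - b * g ^+ 2) ^+ (2 ^ n).

Lemma carrier_seq0 (T : nzRingType) (b g : T) : carrier_seq b g 0 = b * g ^+ 2.
Proof. by rewrite /carrier_seq expn0 expr1 subKr. Qed.

Lemma carrier_seqS (T : nzRingType) (b g : T) n :
  carrier_seq b g n.+1 = 1 - (1 - carrier_seq b g n) ^+ 2.
Proof. by rewrite /carrier_seq subKr expnS mulnC exprM. Qed.

(** * Carriers as suprema of the carrier sequence *)

Section CarrierSequence.
Variables (k : nat) (g : S).
Hypothesis Pg1 : P (1 - c ^+ k * g ^+ 2).

Let v := carrier_seq (c ^+ k) g.

Let v0E : v 0 = c ^+ k * g ^+ 2. Proof. exact: carrier_seq0. Qed.
Let vSE n : v n.+1 = 1 - (1 - v n) ^+ 2. Proof. exact: carrier_seqS. Qed.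

Lemma carrier_seq_le1 n : P (1 - v n).
Proof. by rewrite /v /carrier_seq subKr; apply: cone_exp. Qed.

Lemma carrier_seq_ge0 n : P (v n).
Proof.
elim: n => [|n IH].
  by rewrite v0E; apply: PM; [apply: cone_exp|apply: cone_sqr].
have -> : v n.+1 = v n + v n * (1 - v n) by rewrite vSE; ring.
by apply: PD => //; apply: PM => //; apply: carrier_seq_le1.
Qed.

Lemma carrier_seq_nondecreasing n : P (v n.+1 - v n).
Proof.
have -> : v n.+1 - v n = v n * (1 - v n) by rewrite vSE; ring.
by apply: PM; [apply: carrier_seq_ge0|apply: carrier_seq_le1].
Qed.

(** The supremum [p] is given rather than constructed, so that one and the same [p] can be studied
    inside different bicommutants. *)
Lemma carrier_seq_sup p : cone_sup v p ->
  [/\ p ^+ 2 = p, g * p = g & forall h, g * h = 0 -> p * h = 0].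
Proof.
move=> [vp pmin].
have Pp : P p.
  by rewrite -[p](subrK (v 0)); apply: PD => //; apply: carrier_seq_ge0.
have Pp1 : P (1 - p) by apply: pmin => n; apply: carrier_seq_le1.
have pp : p ^+ 2 = p.
  apply: cone_anti; last first.
    by rewrite -[p in p - _]mulr1 expr2 -mulrBr; apply: PM.
  have -> : p ^+ 2 - p = c * (p + p ^+ 2) - p + (c * (p + p ^+ 2) - p)
      - (c + c - 1) * (p + p ^+ 2) by ring.
  rewrite c2 subrr mul0r subr0.
  suff Pb : P (c * (p + p ^+ 2) - p) by apply: PD.
  (* By the recursion, [v n] is the mean of [v n.+1] and [v n ^+ 2], hence at most the mean of [p]
     and [p ^+ 2]. *)
  apply: pmin => n.
  have -> : c * (p + p ^+ 2) - v n = c * ((p - v n.+1) + (p - v n) * (p + v n))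
     + (c + c - 1) * v n by rewrite vSE; ring.
  rewrite c2 subrr mul0r addr0.
  apply: PM => //; apply: PD => //; apply: PM => //; apply: PD => //.
  exact: carrier_seq_ge0.
have g0 x : c ^+ k * g ^+ 2 * x = 0 -> g * x = 0.
  move=> gx; apply: (cone_reduced HP).
  have -> : (g * x) ^+ 2 = 2 ^+ k * x * (c ^+ k * g ^+ 2 * x)
     + (1 - c ^+ k * 2 ^+ k) * (g * x) ^+ 2 by ring.
  by rewrite gx mulr0 half_exp2 subrr mul0r add0r.
have gp : g * p = g.
  apply/eqP; rewrite -subr_eq0 -{2}[g]mulr1 -mulrBr -oppr_eq0 -mulrN opprB.
  apply/eqP/g0; rewrite -v0E.
  apply: (cone_proper HP); first by apply: PM => //; apply: carrier_seq_ge0.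
  have -> : - (v 0 * (1 - p)) = (p - v 0) * (1 - p) + (p ^+ 2 - p) by ring.
  by rewrite pp subrr addr0; apply: PM.
split=> // h gh.
have vh n : v n * h = 0.
  elim: n => [|n IH]; first by rewrite v0E expr2 -!mulrA gh !mulr0.
  have -> : v n.+1 * h = v n * h * (2 - v n) by rewrite vSE; ring.
  by rewrite IH mul0r.
(* Since [v n * h = 0] and the scaled [h ^+ 2] is at most 1, [p - c ^+ m * h ^+ 2 * p] still bounds
   every [v n]; the subtracted positive term must vanish. *)
have [m Pm] := cone_scale (h ^+ 2).
have ph0 : c ^+ m * h ^+ 2 * p = 0.
  apply: (cone_proper HP).
    by do 2!apply: PM => //; [apply: cone_exp|apply: cone_sqr].
  have -> : - (c ^+ m * h ^+ 2 * p) = p - c ^+ m * h ^+ 2 * p - p by ring.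
  apply: pmin => n.
  have -> : p - c ^+ m * h ^+ 2 * p - v n =
      (p - v n) * (1 - c ^+ m * h ^+ 2) - c ^+ m * h * (v n * h) by ring.
  by rewrite vh mulr0 subr0; apply: PM.
apply: (cone_reduced HP).
have -> : (p * h) ^+ 2 = 2 ^+ m * p * (c ^+ m * h ^+ 2 * p)
   + (1 - c ^+ m * 2 ^+ m) * (p * h) ^+ 2 by ring.
by rewrite ph0 mulr0 half_exp2 subrr mul0r add0r.
Qed.

End CarrierSequence.

Lemma cone_carrier g : exists p,
  [/\ p ^+ 2 = p, g * p = g & forall h : S, g * h = 0 -> p * h = 0].
Proof.
have [k Pk] := cone_scale (g ^+ 2).
have [|p psup] := cone_vigier HP (carrier_seq_nondecreasing Pk).
  by exists 1; apply: carrier_seq_le1.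
by exists p; apply: carrier_seq_sup psup.
Qed.

(* On the carrier p of r + g, which annihilates r - g, one has
   r + g = p (r + g) + p (r - g) = 2 p r. *)
Lemma cone_abs_ge g r : P r -> r ^+ 2 = g ^+ 2 -> P (r + g).
Proof.
move=> Pr rg; have [p [pp gp p0]] := cone_carrier (r + g).
have pb : p * (r - g) = 0.
  by apply: p0; rewrite mulrC -subr_sqr rg subrr.
have -> : r + g = p ^+ 2 * (r + r).
  have -> : p ^+ 2 * (r + r) = p ^+ 2 * (r + g) + p * (p * (r - g)) by ring.
  by rewrite pb pp mulr0 addr0 mulrC gp.
by apply: PM; [apply: cone_sqr|apply: PD].
Qed.

(** Here [r] is the absolute value of [g]. The carrier [p] fixes the positive part [c * (r + g)] and
    kills [r - g], so [g * p] is the positive part and [g * p - g] the negative part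
    [c * (r - g)]. *)
Lemma pos_part_carrier g r p : P r -> r ^+ 2 = g ^+ 2 -> p ^+ 2 = p ->
    (forall h : S, c * (r + g) * h = 0 <-> p * h = 0) ->
  [/\ g * p = c * (r + g), P (g * p) & P (g * p - g)].
Proof.
move=> Pr rg pp pc.
have rp : c * (r + g) * (1 - p) = 0.
  by apply/pc; rewrite mulrBr mulr1 -expr2 pp subrr.
have pb : p * (r - g) = 0.
  apply/pc; rewrite -mulrA [X in _ * X]mulrC -subr_sqr rg subrr mulr0 //.
have gE : g * p = c * (r + g).
  have -> : g * p = c * (r + g) - c * (r + g) * (1 - p) - c * (p * (r - g))
      + (1 - (c + c)) * (g * p) by ring.
  by rewrite rp pb c2 subrr mulr0 mul0r !subr0 addr0.
split=> //; first by rewrite gE; apply: PM => //; apply: cone_abs_ge.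
have -> : g * p - g = c * (r - g) + (1 - (c + c)) * (-g).
  by rewrite gE; ring.
rewrite c2 subrr mul0r addr0; apply: PM => //; apply: cone_abs_ge => //.
by rewrite sqrrN.
Qed.

(** This makes the projections decrease as the threshold grows by [d]. The product
    [(f - d) * q * (1 - p)] is positive, but also negative because [f] is negative off [p]; hence it
    is 0. *)
Lemma carrier_mono f d p q : P d -> P (1 - p) -> P q ->
    P (f * p - f) -> P ((f - d) * q) ->
    (forall h : S, (f - d) * q * h = 0 -> q * h = 0) -> p * q = q.
Proof.
move=> Pd Pp Pq fn fq qc.
have : q * (1 - p) = 0.
  apply: qc; apply: (cone_proper HP); first exact: PM.
  have -> : - ((f - d) * q * (1 - p)) = (f * p - f) * q + d * q * (1 - p) by ring.
  by apply: PD; do ?apply: PM.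
by move/eqP; rewrite mulrBr mulr1 subr_eq0 mulrC => /eqP <-.
Qed.

(* The lower Riemann sum of step d for g: the induction compares its partial
   sums with the truncation min(g, t0 + k d) = g - (g - t0 - k d) e k. *)
Lemma riemann_sum_bounds (g t0 d : S) (e : nat -> S) K :
    P d -> P (g - t0) -> P (t0 + d * K%:R - g) ->
    (forall k, e k ^+ 2 = e k) ->
    (forall k, P ((g - (t0 + d * k%:R)) * e k)) ->
    (forall k, P ((g - (t0 + d * k%:R)) * e k - (g - (t0 + d * k%:R)))) ->
    (forall k, e k * e k.+1 = e k.+1) ->
  let z := t0 + d * \sum_(k < K) e k.+1 in P (g - z) /\ P (z + d - g).
Proof.
move=> Pd Pg PK ee fp fn emono z.
have Pe k : P (e k) by rewrite -ee; apply: cone_sqr.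
have Pe1 k : P (1 - e k).
  have -> : 1 - e k = (1 - e k) ^+ 2 - (e k ^+ 2 - e k) by ring.
  by rewrite ee subrr subr0; apply: cone_sqr.
pose f k := g - (t0 + d * k%:R).
pose s k := t0 + d * \sum_(i < k) e i.+1.
have fS k : f k.+1 = f k - d by rewrite /f mulrS; ring.
have sS k : s k.+1 = s k + d * e k.+1 by rewrite /s big_ord_recr /=; ring.
(* From [k] to [k.+1] the truncation grows by at most [d * e k], the sum only by [d * e k.+1]; the
   extra term [- d * e k] absorbs the difference. *)
have H k : P (g - f k * e k - s k) /\ P (s k + d - (g - f k * e k) - d * e k).
  elim: k => [|k [IH1 IH2]].
    have f0 : f 0 = g - t0 by rewrite /f mulr0 addr0.
    have -> : s 0 = t0 by rewrite /s big_ord0 mulr0 addr0.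
    split.
      have -> : g - f 0 * e 0 - t0 = f 0 * (1 - e 0) by rewrite f0; ring.
      by apply: PM => //; rewrite f0.
    have -> : t0 + d - (g - f 0 * e 0) - d * e 0 =
        d * (1 - e 0) + (f 0 * e 0 - f 0) by rewrite f0; ring.
    by apply: PD; [apply: PM|apply: fn].
  split.
    have -> : g - f k.+1 * e k.+1 - s k.+1 =
        (g - f k * e k - s k) + f k * e k * (1 - e k.+1)
        + f k * (e k * e k.+1 - e k.+1) by rewrite sS fS; ring.
    rewrite emono subrr mulr0 addr0; apply: PD => //; apply: PM => //; exact: fp.
  have -> : s k.+1 + d - (g - f k.+1 * e k.+1) - d * e k.+1 =
      (s k + d - (g - f k * e k) - d * e k)
      + e k * (f k.+1 * e k.+1 - f k.+1)
      - f k.+1 * (e k * e k.+1 - e k.+1) by rewrite sS fS; ring.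
  by rewrite emono subrr mulr0 subr0; apply: PD => //; apply: PM => //; apply: fn.
have [H1 H2] := H K.
(* At the last grid point [g <= t0 + d * K], so the truncation is [g] itself. *)
have fK : f K * e K = 0.
  apply: cone_proper HP _ (fp K) _.
  have -> : - (f K * e K) = (t0 + d * K%:R - g) * e K by rewrite /f; ring.
  exact: PM.
move: H1 H2; rewrite fK subr0 => H1 H2; split=> //.
rewrite -/(s K) in H2 *.
have -> : s K + d - g = (s K + d - g - d * e K) + d * e K by rewrite subrK.
by apply: PD => //; apply: PM.
Qed.

End VigierCone.

(** * Formal properties of commutants and bicommutants *)

Section Commutants.
Variables (R : nzRingType) (E : set R).

Lemma sub_commutant (A B : set R) : A `<=` B -> commutant E B `<=` commutant E A.
Proof. by move=> AB x [Gx xB]; split=> // a /AB /xB. Qed.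

Lemma sub_bicommutant (A : set R) : A `<=` dgroup E -> A `<=` bicommutant E A.
Proof. by move=> GA a Aa; split=> [|x [_ xA]]; [apply: GA|apply/commr_sym/xA]. Qed.

Lemma bicommutantS (A B : set R) : A `<=` B -> bicommutant E A `<=` bicommutant E B.
Proof. by move=> AB; do 2!apply: sub_commutant. Qed.

Lemma commutant1_bicommutant g x :
  bicommutant E [set g] x -> commutant E [set g] `<=` commutant E [set x].
Proof. by move=> [Gx xC] y Cy; split=> [|_ ->]; [case: Cy|apply/commr_sym/xC]. Qed.

Lemma bicommutant1_trans g x :
  bicommutant E [set g] x -> bicommutant E [set x] `<=` bicommutant E [set g].
Proof. by move=> /commutant1_bicommutant /sub_commutant. Qed.

Lemma bicommutant_comm g x y : dgroup E y ->
  bicommutant E [set g] x -> GRing.comm y g -> GRing.comm y x.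
Proof. by move=> Gy [_ xC] yg; apply/commr_sym/xC; split=> // _ ->. Qed.

End Commutants.

(** * Order and closure properties of the directed group *)

Section ERingOrder.
Variables (R : nzRingType) (E : set R) (HE : is_AH_algebra E).
Let HR := AH_ering HE.

Lemma effect_Eplus e : E e -> Eplus E e.
Proof.
by move=> Ee; exists [:: e]; rewrite ?big_seq1 // => x; rewrite inE => /eqP ->.
Qed.

Lemma Eplus0 : Eplus E 0. Proof. exact/effect_Eplus/(ering_0 HR). Qed.

Lemma Eplus1 : Eplus E 1. Proof. exact/effect_Eplus/(ering_1 HR). Qed.

Lemma EplusD x y : Eplus E x -> Eplus E y -> Eplus E (x + y).
Proof.
move=> [s sE ->] [t tE ->]; exists (s ++ t); last by rewrite big_cat.
by move=> e; rewrite mem_cat => /orP[/sE|/tE].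
Qed.

Lemma Eplus_dgroup x : Eplus E x -> dgroup E x.
Proof. by move=> Ex; exists x, 0; split=> //; [apply: Eplus0|rewrite subr0]. Qed.

Lemma dgroup0 : dgroup E 0. Proof. exact/Eplus_dgroup/Eplus0. Qed.

Lemma dgroup1 : dgroup E 1. Proof. exact/Eplus_dgroup/Eplus1. Qed.

Lemma dgroupB x y : dgroup E x -> dgroup E y -> dgroup E (x - y).
Proof.
move=> [a [b [Pa Pb ->]]] [a' [b' [Pa' Pb' ->]]].
exists (a + b'), (b + a'); split; [exact: EplusD..|].
by rewrite opprB addrACA opprD.
Qed.

Lemma dgroupD x y : dgroup E x -> dgroup E y -> dgroup E (x + y).
Proof.
move=> Gx Gy; rewrite -[y]opprK; apply: dgroupB => //.
by rewrite -sub0r; apply: dgroupB => //; apply: dgroup0.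
Qed.

Lemma Eplus_sqr x : dgroup E x -> Eplus E (x ^+ 2).
Proof. by move=> [a [b [Pa Pb ->]]]; apply: (ering_sqr HR). Qed.

(** Every effect is at most 1, so a sum of [n] effects is at most [n]. *)
Lemma Eplus_unit x : dgroup E x -> exists n : nat, Eplus E (n%:R - x).
Proof.
suff bnd a : Eplus E a -> exists n : nat, Eplus E (n%:R - a).
  move=> [a [b [/bnd[n Pn] Pb ->]]]; exists n.
  by rewrite opprB addrCA addrC; apply: EplusD.
move=> [s sE ->]; elim: s sE => [|e s IH] sE.
  by exists 0%N; rewrite big_nil subr0; apply: Eplus0.
have [|n Pn] := IH; first by move=> e' es; apply: sE; rewrite inE es orbT.
exists n.+1; rewrite big_cons mulrS opprD addrACA; apply: EplusD => //.
by apply/effect_Eplus/(ering_compl HR)/sE; rewrite inE eqxx.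
Qed.

(** If [x * y = 0] then [x * y ^+ 2 * x = 0], and quadratic annihilation gives both products. *)
Lemma dgroup_comm_mul0 x y :
  dgroup E x -> dgroup E y -> x * y = 0 -> y * x = 0.
Proof.
by move=> Gx Gy xy; case: (AH_QA HE Gx Gy) => //; rewrite expr2 mulrA xy !mul0r.
Qed.

Variable c : R.
Hypotheses (Ec : E c) (c2 : c + c = 1).

(** Both [x * c] and [c * x] double to [x], and doubling is injective with left inverse [c]. *)
Lemma half_central x : GRing.comm x c.
Proof.
have c2x : x * c + x * c = c * x + c * x.
  by rewrite -mulrDr -mulrDl c2 mul1r mulr1.
have cK z : c * (z + z) = z by rewrite mulrDr -mulrDl c2 mul1r.
by rewrite /GRing.comm -[LHS]cK c2x cK.
Qed.

Lemma dgroup_half x : dgroup E x -> dgroup E (c * x).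
Proof.
move=> [a [b [Pa Pb ->]]]; have Pc := effect_Eplus Ec.
exists (c * a), (c * b); rewrite mulrBr.
by split=> //; apply: (ering_comm_mul HR) => //; apply/esym/half_central.
Qed.

(** Polarisation: for commuting elements the product is half of [(x + y) ^+ 2 - x ^+ 2 - y ^+ 2]. *)
Lemma dgroup_mul x y : dgroup E x -> dgroup E y -> x * y = y * x ->
  dgroup E (x * y).
Proof.
move=> Gx Gy xy.
have -> : x * y = c * ((x + y) ^+ 2 - x ^+ 2 - y ^+ 2).
  have -> : (x + y) ^+ 2 - x ^+ 2 - y ^+ 2 = x * y + x * y.
    rewrite !expr2 mulrDl !mulrDr -xy [x * y + y * y]addrC addrACA.
    by rewrite -[LHS]addrA -opprD addrAC subrr add0r.
  by rewrite mulrDr -mulrDl c2 mul1r.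
apply: dgroup_half; apply: dgroupB; first apply: dgroupB.
- by apply/Eplus_dgroup/Eplus_sqr/dgroupD.
- exact/Eplus_dgroup/Eplus_sqr.
- exact/Eplus_dgroup/Eplus_sqr.
Qed.

End ERingOrder.

(* The hypotheses are parameters of the predicate so that its closure
   properties can be declared as canonical instances. *)
Definition bicomm_pred (R : nzRingType) (E : set R) (HE : is_AH_algebra E)
  (A : set R) (HA : A `<=` commutant E A) : {pred R} :=
  fun x => `[< bicommutant E A x >].

(** * The bicommutant of a commuting set as a commutative ring with a Vigier cone *)

Section BicommutantRing.
Variables (R : nzRingType) (E : set R) (HE : is_AH_algebra E).
Variables (A : set R) (HA : A `<=` commutant E A).

Lemma bicomm_predP x : reflect (bicommutant E A x) (x \in bicomm_pred HE HA).
Proof. exact: asboolP. Qed.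

(** As [A] lies in its own commutant, its bicommutant lies in its commutant too. *)
Lemma bicommutant_commutes x y :
  bicommutant E A x -> bicommutant E A y -> x * y = y * x.
Proof. by move=> [Gx xC] yCC; apply/xC/(sub_commutant HA). Qed.

Lemma bicomm_subring : subring_closed (bicomm_pred HE HA).
Proof.
have [c Ec c2] := AH_half HE.
split=> [|x y /bicomm_predP xC /bicomm_predP yC|x y /bicomm_predP xC /bicomm_predP yC];
  apply/bicomm_predP; split.
- exact: dgroup1.
- by move=> a _; apply/commr_sym/commr1.
- by apply: dgroupB; [case: xC|case: yC].
- by move=> a aA; apply/commr_sym/commrB; apply/commr_sym; [case: xC|case: yC]=> _; apply.
- apply: (dgroup_mul HE Ec c2); [by case: xC|by case: yC|].
  exact: bicommutant_commutes.
- by move=> a aA; apply/commr_sym/commrM; apply/commr_sym; [case: xC|case: yC]=> _; apply.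
Qed.

HB.instance Definition _ := GRing.isSubringClosed.Build R (bicomm_pred HE HA) bicomm_subring.

Definition bicomm_ring := {x : R | x \in bicomm_pred HE HA}.
HB.instance Definition _ := SubChoice.on bicomm_ring.
HB.instance Definition _ := [SubChoice_isSubNzRing of bicomm_ring by <:].

Lemma bicomm_ring_comm (x y : bicomm_ring) : x * y = y * x.
Proof.
apply: val_inj; rewrite !rmorphM; apply: bicommutant_commutes.
  exact/bicomm_predP/(valP x).
exact/bicomm_predP/(valP y).
Qed.
HB.instance Definition _ := GRing.PzRing_hasCommutativeMul.Build bicomm_ring bicomm_ring_comm.

Definition bicomm_val (x : bicomm_ring) : R := val x.
Arguments bicomm_val : simpl never.
HB.instance Definition _ := GRing.RMorphism.copy bicomm_val (val : bicomm_ring -> R).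

Lemma bicomm_val_inj : injective bicomm_val.
Proof. exact: val_inj. Qed.

Definition bicomm_lift x (xC : bicommutant E A x) : bicomm_ring :=
  exist _ x (introT (bicomm_predP x) xC).

Lemma bicomm_ringP (x : bicomm_ring) : bicommutant E A (bicomm_val x).
Proof. exact/bicomm_predP/(valP x). Qed.

Lemma bicommutant_half c : E c -> c + c = 1 -> bicommutant E A c.
Proof.
move=> Ec c2; split; first exact/Eplus_dgroup/effect_Eplus.
by move=> a _; apply/commr_sym/half_central.
Qed.

Definition bicomm_cone : set bicomm_ring := [set x | Eplus E (bicomm_val x)].

Lemma bicomm_vigier_cone c (Ec : E c) (c2 : c + c = 1) :
  vigier_cone bicomm_cone (bicomm_lift (bicommutant_half Ec c2)).
Proof.
have G (x : bicomm_ring) : dgroup E (bicomm_val x) by case: (bicomm_ringP x).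
have HR := AH_ering HE.
split; rewrite /bicomm_cone /=.
- by move=> x y Px Py; rewrite rmorphD; apply: EplusD.
- move=> x y Px Py; rewrite rmorphM; apply: (ering_comm_mul HR) => //.
  exact: bicommutant_commutes (bicomm_ringP x) (bicomm_ringP y).
- by move=> x; rewrite rmorphXn; apply: Eplus_sqr.
- move=> x Px; rewrite rmorphN => Pnx; apply: bicomm_val_inj.
  exact: (ering_proper HR).
- move=> x /(congr1 bicomm_val); rewrite rmorphXn rmorph0 => x0; apply: bicomm_val_inj.
  (* Reducedness is quadratic annihilation with left factor 1. *)
  have [|] := AH_QA HE (dgroup1 HE) (G x); first by rewrite x0 mulr0 mul0r.
  by rewrite mul1r.
- exact: effect_Eplus.
- exact: bicomm_val_inj.
- move=> x; have [n Pn] := Eplus_unit HE (G x); exists n.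
  by rewrite rmorphB rmorph_nat.
- move=> u uS [b ub].
  have [|||| g [_ g1 g2] gC] := AH_CV HE (u := fun n => bicomm_val (u n)).
  + by move=> n; apply: G.
  + by move=> n; have := uS n; rewrite rmorphB.
  + by move=> m n; apply: bicommutant_commutes; apply: bicomm_ringP.
  + by exists (bicomm_val b) => // n; have := ub n; rewrite rmorphB.
  (* Whatever commutes with [A] commutes with every [u n], hence with the Vigier supremum; so the
     supremum stays in the ring. *)
  have gA : bicommutant E A g.
    apply: sub_commutant gC => y [Gy yA]; split=> // _ [n _ <-].
    by apply/commr_sym; case: (bicomm_ringP (u n)) => _; apply.
  exists (bicomm_lift gA); split=> [n|b' ub'] /=; rewrite rmorphB /=.
    exact: g1.
  by apply: g2 => // n; have /= := ub' n; rewrite rmorphB.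
Qed.

End BicommutantRing.

Arguments bicomm_val {R E HE A HA} x : simpl never.

(** * Square roots, carriers and spectral projections in [G] *)

Section SpectralTheory.
Variables (R : nzRingType) (E : set R) (HE : is_AH_algebra E).
Variables (c : R) (Ec : E c) (c2 : c + c = 1).

Lemma set1_commuting g : dgroup E g -> [set g] `<=` commutant E [set g].
Proof. by move=> Gg _ ->; split=> // _ ->. Qed.

Lemma set2_commuting g h : dgroup E g -> dgroup E h -> GRing.comm g h ->
  [set g; h] `<=` commutant E [set g; h].
Proof.
by move=> Gg Gh gh _ [] ->; split=> // _ [] -> //; apply: commr_sym.
Qed.

Lemma bicommutant1 g : dgroup E g -> bicommutant E [set g] g.
Proof. by move=> Gg; apply: sub_bicommutant => // _ ->. Qed.

Lemma bicommutant_sqr g : dgroup E g -> bicommutant E [set g] (g ^+ 2).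
Proof.
move=> Gg; split; first exact/Eplus_dgroup/Eplus_sqr.
by move=> a [_ /(_ g erefl) ag]; apply/commr_sym/commrX.
Qed.

Lemma sqrt_exists g : Eplus E g ->
  exists r, [/\ bicommutant E [set g] r, Eplus E r & r ^+ 2 = g].
Proof.
move=> Pg; have Gg := Eplus_dgroup HE Pg.
have HC := bicomm_vigier_cone HE (set1_commuting Gg) Ec c2.
have [r Pr rE] := cone_sqrt HC (g := bicomm_lift HE (set1_commuting Gg) (bicommutant1 Gg)) Pg.
exists (bicomm_val r); split=> //; first exact: bicomm_ringP.
by rewrite -rmorphXn rE.
Qed.

(** The selected root [q] satisfies [g = q ^+ 2], so the root [r] constructed in the bicommutant of
    [g] lies in that of [q]. Both roots are thus in one commutative ring, where roots are unique. *)
Lemma esqrt_spec g : Eplus E g ->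
  [/\ bicommutant E [set g] (esqrt E g), Eplus E (esqrt E g) & esqrt E g ^+ 2 = g].
Proof.
move=> Pg; have [r [rC Pr rg]] := sqrt_exists Pg.
have [Gq] : [set x | [/\ dgroup E x, ele E 0 x & x ^+ 2 = g]] (esqrt E g).
  by apply: xgetPex; exists r; split=> //; [case: rC|rewrite /ele subr0].
rewrite /ele subr0; move: (esqrt E g) Gq => q Gq Pq qg.
suff -> : q = r by [].
have qC := bicommutant1 Gq.
have {}rC : bicommutant E [set q] r.
  by apply: bicommutant1_trans rC; rewrite -qg; apply: bicommutant_sqr.
have HC := bicomm_vigier_cone HE (set1_commuting Gq) Ec c2.
suff /(congr1 bicomm_val) : bicomm_lift HE (set1_commuting Gq) qC
  = bicomm_lift HE (set1_commuting Gq) rC by [].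
by apply: (cone_sqrt_uniq HC) => //; apply: bicomm_val_inj; rewrite !rmorphXn /= qg rg.
Qed.

Lemma eabs_spec g : dgroup E g ->
  [/\ bicommutant E [set g] (eabs E g), Eplus E (eabs E g) & eabs E g ^+ 2 = g ^+ 2].
Proof.
move=> Gg; have [rC Pr rg] := esqrt_spec (Eplus_sqr HE Gg).
split=> //; exact: bicommutant1_trans (bicommutant_sqr Gg) _ rC.
Qed.

Lemma val_carrier_seq (A : set R) (HA : A `<=` commutant E A)
    (b g : bicomm_ring HE HA) n :
  bicomm_val (carrier_seq b g n) = carrier_seq (bicomm_val b) (bicomm_val g) n.
Proof. by rewrite /carrier_seq !(rmorphB, rmorphXn, rmorphM, rmorph1). Qed.

Lemma carrier_sup (A : set R) (HA : A `<=` commutant E A) k g p :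
    bicommutant E A g -> bicommutant E A p ->
    Eplus E (1 - c ^+ k * g ^+ 2) -> is_supremum E (carrier_seq (c ^+ k) g) p ->
  [/\ p ^+ 2 = p, g * p = g &
      forall h, bicommutant E A h -> g * h = 0 -> p * h = 0].
Proof.
move=> gC pC Pk [_ p1 p2].
have HC := bicomm_vigier_cone HE HA Ec c2.
have Pk1 : bicomm_cone (1 - bicomm_lift HE HA (bicommutant_half HE A Ec c2) ^+ k *
    bicomm_lift HE HA gC ^+ 2).
  by rewrite /bicomm_cone /= rmorphB rmorphM !rmorphXn.
have [|pp gp ph] := carrier_seq_sup HC Pk1 (p := bicomm_lift HE HA pC).
  split=> [n|b ub]; rewrite /bicomm_cone /= rmorphB /=.
    by rewrite val_carrier_seq rmorphXn; apply: p1.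
  apply: p2 => [|n]; first by case: (bicomm_ringP b).
  by have := ub n; rewrite /bicomm_cone /= rmorphB /= val_carrier_seq rmorphXn.
split.
- by have := congr1 bicomm_val pp; rewrite rmorphXn.
- by have := congr1 bicomm_val gp; rewrite rmorphM.
move=> h hC gh.
have ph0 : bicomm_lift HE HA pC * bicomm_lift HE HA hC = 0.
  by apply: ph; apply: bicomm_val_inj; rewrite rmorphM rmorph0.
by have := congr1 bicomm_val ph0; rewrite rmorphM rmorph0.
Qed.

(** An [h] with [g * h = 0] may lie outside the bicommutant of [g]. It commutes with [g], however,
    so the same supremum [p] is examined again in the bicommutant of [[set g; h]]. *)
Lemma carrier_exists g : dgroup E g -> exists p,
  [/\ projections E p, bicommutant E [set g] p &
      forall h, dgroup E h -> (g * h = 0 <-> p * h = 0)].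
Proof.
move=> Gg; have HA := set1_commuting Gg.
have HC := bicomm_vigier_cone HE HA Ec c2.
pose s := bicomm_lift HE HA (bicommutant1 Gg).
have [k Pk] := cone_scale HC (s ^+ 2).
pose u := carrier_seq (c ^+ k) g.
have uE n : u n = bicomm_val (carrier_seq (bicomm_lift HE HA (bicommutant_half HE _ Ec c2) ^+ k) s n).
  by rewrite val_carrier_seq rmorphXn.
have uC n : bicommutant E [set g] (u n) by rewrite uE; apply: bicomm_ringP.
have [|||| p psup pC] := AH_CV HE (u := u).
- by move=> n; case: (uC n).
- move=> n; have := carrier_seq_nondecreasing HC Pk n.
  by rewrite /bicomm_cone /= rmorphB /= -!uE.
- by move=> m n; apply: bicommutant_commutes (uC m) (uC n).
- exists 1; first exact: dgroup1.
  move=> n; have := carrier_seq_le1 HC Pk n.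
  by rewrite /bicomm_cone /= rmorphB /= -!uE.
have {}pC : bicommutant E [set g] p.
  apply: sub_commutant pC => y [Gy yA]; split=> // _ [n _ <-].
  by apply/commr_sym; case: (uC n) => _; apply.
have Pk' : Eplus E (1 - c ^+ k * g ^+ 2).
  by move: Pk; rewrite /bicomm_cone /= rmorphB rmorphM !rmorphXn.
have [pp gp _] := carrier_sup HA (bicommutant1 Gg) pC Pk' psup.
have Gp : dgroup E p by case: pC.
exists p; split=> // h Gh; split=> [gh|ph]; last by rewrite -gp -mulrA ph mulr0.
have cgh : GRing.comm g h by rewrite /GRing.comm gh (dgroup_comm_mul0 HE Gg Gh gh).
have sub : [set g; h] `<=` bicommutant E [set g; h].
  by apply: sub_bicommutant => _ [] ->.
have [|| _ _] := carrier_sup (set2_commuting Gg Gh cgh) _ _ Pk' psup.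
- by apply: sub; left.
- by apply: bicommutantS pC => _ ->; left.
by apply=> //; apply: sub; right.
Qed.

(** Uniqueness: two carriers satisfy [q * (1 - p) = 0] and [p * (1 - q) = 0]. Reversing the second
    product gives [p = q * p = q]. *)
Lemma carrier_spec g : dgroup E g ->
  [/\ projections E (carrier E g), bicommutant E [set g] (carrier E g) &
      forall h, dgroup E h -> (g * h = 0 <-> carrier E g * h = 0)].
Proof.
move=> Gg; have [p [Hp pC pg]] := carrier_exists Gg.
have [] : [set q | projections E q /\ forall h, dgroup E h -> (g * h = 0 <-> q * h = 0)]
    (carrier E g) by apply: xgetPex; exists p.
move: (carrier E g) => q Hq qg; suff -> : q = p by [].
have killC r : projections E r -> dgroup E (1 - r) /\ r * (1 - r) = 0.
  move=> [Gr rr]; split; first by apply: dgroupB => //; apply: dgroup1.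
  by rewrite mulrBr mulr1 -expr2 -rr subrr.
have qp : q = q * p.
  have [G1 p0] := killC p Hp.
  have /(qg _ G1) : g * (1 - p) = 0 by apply/pg.
  by rewrite mulrBr mulr1 => /eqP; rewrite subr_eq0 => /eqP.
have [G1 q0] := killC q Hq.
have /(pg _ G1) : g * (1 - q) = 0 by apply/qg.
move=> /(dgroup_comm_mul0 HE (proj1 Hp) G1).
by rewrite mulrBl mul1r => /eqP; rewrite subr_eq0 => /eqP p_qp; rewrite qp -p_qp.
Qed.

(** The complement of the spectral projection of [f] at 0, written with [c] so that it lives in the
    ring alone. *)
Definition upper_proj f := carrier E (c * (eabs E f + f)).

Lemma upper_proj_spec f : dgroup E f ->
  [/\ projections E (upper_proj f), bicommutant E [set f] (upper_proj f),
      Eplus E (f * upper_proj f), Eplus E (f * upper_proj f - f) &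
      forall h, dgroup E h -> f * upper_proj f * h = 0 -> upper_proj f * h = 0].
Proof.
move=> Gf; have HA := set1_commuting Gf.
have HC := bicomm_vigier_cone HE HA Ec c2.
have [rC Pr rf] := eabs_spec Gf.
pose sc := bicomm_lift HE HA (bicommutant_half HE _ Ec c2).
pose sf := bicomm_lift HE HA (bicommutant1 Gf).
pose sr := bicomm_lift HE HA rC.
have aE : bicomm_val (sc * (sr + sf)) = c * (eabs E f + f).
  by rewrite rmorphM rmorphD.
have aC : bicommutant E [set f] (c * (eabs E f + f)).
  by rewrite -aE; apply: bicomm_ringP.
have [Gp] := carrier_spec (proj1 aC).
rewrite -/(upper_proj f) => /(bicommutant1_trans aC) pC pker.
pose sp := bicomm_lift HE HA pC.
have [|||gE P1 P2] := pos_part_carrier HC (g := sf) (r := sr) (p := sp) Pr.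
- by apply: bicomm_val_inj; rewrite !rmorphXn.
- by apply: bicomm_val_inj; rewrite rmorphXn /=; case: Gp.
- move=> h; have [Gh _] := bicomm_ringP h; have [k1 k2] := pker _ Gh.
  split=> /(congr1 bicomm_val); rewrite rmorphM rmorph0 => h0; apply: bicomm_val_inj;
    rewrite rmorphM rmorph0.
    by apply: k1; rewrite -aE.
  by rewrite /= aE; apply: k2.
have fpE : f * upper_proj f = c * (eabs E f + f).
  by rewrite -aE -gE rmorphM.
split=> // h Gh; rewrite fpE => h0; exact/pker.
Qed.

(* The sequence z n - 2 c^n is ascending, so that y is its supremum and the
   commutative Vigier property applies. *)
Lemma comm_approx x y : dgroup E x -> dgroup E y ->
    (forall n, exists z, [/\ bicommutant E [set y] z, GRing.comm x z,
       Eplus E (y - z) & Eplus E (z + c ^+ n - y)]) ->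
  GRing.comm x y.
Proof.
move=> Gx Gy /choice[z zP]; have HA := set1_commuting Gy.
have HC := bicomm_vigier_cone HE HA Ec c2.
pose d := bicomm_lift HE HA (bicommutant_half HE _ Ec c2).
have d2 := cone_halfD HC.
pose sy := bicomm_lift HE HA (bicommutant1 Gy).
have zC n : bicommutant E [set y] (z n) by case: (zP n).
pose sz n := bicomm_lift HE HA (zC n).
have Pd n : bicomm_cone (d ^+ n) by apply: (cone_exp HC); apply: cone_half HC.
have z1 n : bicomm_cone (sy - sz n).
  by rewrite /bicomm_cone /= rmorphB; case: (zP n).
have z2 n : bicomm_cone (sz n + d ^+ n - sy).
  by rewrite /bicomm_cone /= rmorphB rmorphD rmorphXn; case: (zP n).
pose w n := sz n - 2 * d ^+ n.
have wS n : bicomm_cone (w n.+1 - w n).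
  (* The approximations drop by at most [d ^+ n.+1], while the correction gains twice that. *)
  have -> : w n.+1 - w n = (sz n.+1 + d ^+ n.+1 - sy) + (sy - sz n) + d ^+ n.+1
      + (1 - (d + d)) * (2 * d ^+ n) by rewrite /w exprS; ring.
  by rewrite d2 subrr mul0r addr0; do 2!apply: (coneD HC) => //.
have wy n : bicomm_cone (sy - w n).
  have -> : sy - w n = (sy - sz n) + d ^+ n + d ^+ n by rewrite /w; ring.
  by do 2!apply: (coneD HC) => //.
have [|||| v [_ v1 v2] vC] := AH_CV HE (u := fun n => bicomm_val (w n)).
- by move=> n; case: (bicomm_ringP (w n)).
- by move=> n; have := wS n; rewrite /bicomm_cone /= rmorphB.
- by move=> m n; apply: bicommutant_commutes (bicomm_ringP _) (bicomm_ringP _).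
- by exists y => // n; have := wy n; rewrite /bicomm_cone /= rmorphB.
have vy : bicommutant E [set y] v.
  apply: sub_commutant vC => a [Ga aA]; split=> // _ [n _ <-].
  by apply/commr_sym; case: (bicomm_ringP (w n)) => _; apply.
pose sv := bicomm_lift HE HA vy.
have e1 : bicomm_cone (sy - sv).
  rewrite /bicomm_cone /= rmorphB; apply: v2 => [|n]; first by [].
  by have := wy n; rewrite /bicomm_cone /= rmorphB.
have e2 : bicomm_cone (sv - sy).
  apply: (cone_archimedean HC) => n.
  (* The gap between [sy] and [w n.+2] is at most [3 * d ^+ n.+2], which is below [d ^+ n]; hence
     the shift by two. *)
  have -> : sv - sy + d ^+ n =
      (sv - w n.+2) + (sz n.+2 + d ^+ n.+2 - sy) + d ^+ n.+2
      + (1 - (d + d) ^+ 2) * d ^+ n by rewrite /w !exprS; ring.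
  rewrite d2 expr1n subrr mul0r addr0; do 2!apply: (coneD HC) => //.
  by rewrite /bicomm_cone /= rmorphB; apply: v1.
have /(congr1 bicomm_val) : sy = sv by apply: cone_anti HC _ _ e1 e2.
move=> /= yv; rewrite -[y]/(bicomm_val sy) yv.
apply/commr_sym; case: vC => _; apply; split=> // _ [n _ <-].
rewrite rmorphB rmorphM rmorphXn rmorph_nat.
apply: commrB; first by case: (zP n).
by apply: commrM; [apply: commr_nat|apply/commrX/(half_central c2)].
Qed.

(** Puts the grid points of the Riemann sum into the form of the thresholds in [comm_upper_proj]. *)
Lemma dyadic_shiftE (m k n : nat) :
  - m%:R + c ^+ n * k%:R = (k%:Z - (m * 2 ^ n)%:Z)%:~R * c ^+ n.
Proof.
have c2n : 2 ^+ n * c ^+ n = 1 :> R.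
  rewrite -exprMn_comm; last exact/half_central.
  by rewrite mulrDl mul1r c2 expr1n.
rewrite rmorphB /= mulrBl -!pmulrn natrM natrX -mulrA c2n mulr1 addrC.
by congr (_ - _); apply/commr_nat.
Qed.

Lemma upper_proj_bicommutant g f :
  bicommutant E [set g] f -> bicommutant E [set g] (upper_proj f).
Proof. by move=> fC; case: (upper_proj_spec (proj1 fC)) => _ /(bicommutant1_trans fC). Qed.

(** The lower Riemann sums of [g] on dyadic grids lie in the bicommutant of [g], commute with [x]
    and come within [c ^+ n] of [g], so [comm_approx] applies. *)
Lemma comm_upper_proj x g : dgroup E x -> dgroup E g ->
    (forall (m : int) n, GRing.comm x (upper_proj (g - m%:~R * c ^+ n))) ->
  GRing.comm x g.
Proof.
move=> Gx Gg xe; apply: comm_approx => // n; have HA := set1_commuting Gg.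
have HC := bicomm_vigier_cone HE HA Ec c2.
have [M PM] := Eplus_unit HE Gg.
have [m Pm] : exists m : nat, Eplus E (m%:R + g).
  have [|m Pm] := Eplus_unit HE (x := - g).
    by rewrite -sub0r; apply: dgroupB => //; apply: dgroup0.
  by exists m; rewrite opprK in Pm.
pose sc := bicomm_lift HE HA (bicommutant_half HE _ Ec c2).
pose sg := bicomm_lift HE HA (bicommutant1 Gg).
pose t0 : bicomm_ring HE HA := - m%:R.
pose d := sc ^+ n.
pose F k := sg - (t0 + d * k%:R).
have FE k : bicomm_val (F k) = g - (k%:Z - (m * 2 ^ n)%:Z)%:~R * c ^+ n.
  by rewrite -dyadic_shiftE rmorphB rmorphD rmorphN rmorphM rmorphXn !rmorph_nat.
have FC k : bicommutant E [set g] (bicomm_val (F k)) by apply: bicomm_ringP.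
pose e k := bicomm_lift HE HA (upper_proj_bicommutant (FC k)).
have spec k := upper_proj_spec (proj1 (FC k)).
have ee k : e k ^+ 2 = e k.
  by apply: bicomm_val_inj; rewrite rmorphXn /=; case: (spec k) => -[].
have Pe k : bicomm_cone (e k) by rewrite -ee; apply: (cone_sqr HC).
have fp k : bicomm_cone (F k * e k).
  by rewrite /bicomm_cone /= rmorphM; case: (spec k).
have fn k : bicomm_cone (F k * e k - F k).
  by rewrite /bicomm_cone /= rmorphB rmorphM; case: (spec k).
have FS k : F k - d = F k.+1 by rewrite /F mulrS; ring.
have Pd : bicomm_cone d by apply: (cone_exp HC); apply: cone_half HC.
have emono k : e k * e k.+1 = e k.+1.
  apply: (carrier_mono HC (f := F k) (d := d)) => //; rewrite ?FS //.
    have -> : 1 - e k = (1 - e k) ^+ 2 - (e k ^+ 2 - e k) by ring.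
    by rewrite ee subrr subr0; apply: (cone_sqr HC).
  move=> h /(congr1 bicomm_val); rewrite !rmorphM rmorph0 => h0.
  apply: bicomm_val_inj; rewrite rmorphM rmorph0.
  by case: (spec k.+1) => _ _ _ _; apply => //; case: (bicomm_ringP h).
(* The grid runs from [- m] to [M] in steps of [c ^+ n]. *)
have [||z1 z2] := riemann_sum_bounds HC (K := (m + M) * 2 ^ n) Pd _ _ ee fp fn emono.
- by rewrite /bicomm_cone /= rmorphB rmorphN rmorph_nat opprK addrC.
- have -> : t0 + d * ((m + M) * 2 ^ n)%:R - sg = M%:R - sg.
    rewrite natrM natrX natrD.
    have -> : t0 + d * ((m%:R + M%:R) * 2 ^+ n) - sg =
       t0 + (d * 2 ^+ n) * (m%:R + M%:R) - sg by ring.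
    by rewrite (half_exp2 HC) mul1r /t0; ring.
  by rewrite /bicomm_cone /= rmorphB rmorph_nat.
set z := t0 + _ in z1 z2; exists (bicomm_val z); split.
- exact: bicomm_ringP.
- rewrite /z rmorphD rmorphM rmorphXn rmorphN rmorph_nat rmorph_sum.
  apply: commrD; first exact/commrN/commr_nat.
  apply: commrM; first exact/commrX/(half_central c2).
  apply: commr_sum => i _.
  by have := xe (i.+1%:Z - (m * 2 ^ n)%:Z) n; rewrite -FE.
- by have := z1; rewrite /bicomm_cone /= rmorphB.
- by have := z2; rewrite /bicomm_cone /= rmorphB rmorphD rmorphXn.
Qed.

(** * Real scalars and the spectral resolution *)

Section RealScalars.
Variables (K : realType) (s : K -> R -> R) (Hs : is_real_ordered_space E s).

Lemma scal_half f : dgroup E f -> s 2^-1 f = c * f.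
Proof.
move=> Gf.
have ff : s 2^-1 f + s 2^-1 f = f.
  by rewrite -(scalDl Hs) // -[in RHS](scal1 Hs Gf); congr s; field.
by rewrite -{2}ff mulrDr -mulrDl c2 mul1r.
Qed.

Lemma spectral_projE f l : dgroup E f ->
  spectral_proj E s f l = 1 - upper_proj (f - s l 1).
Proof.
move=> Gf; rewrite /spectral_proj /epos scal_half //.
have Gd : dgroup E (f - s l 1).
  by apply: dgroupB => //; apply: (scal_closed Hs); apply: dgroup1.
by apply: dgroupD => //; case: (eabs_spec Gd) => -[].
Qed.

Lemma scal_nat (n : nat) l : s (n%:R * l) 1 = n%:R * s l 1.
Proof.
have G1 := dgroup1 HE.
elim: n => [|n IH].
  apply: (addrI (s 0 1)); rewrite !mul0r addr0 -(scalDl Hs) //.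
  by rewrite addr0.
by rewrite !mulrS !mulrDl !mul1r (scalDl Hs) // IH.
Qed.

Lemma scal_int (m : int) l : s (m%:~R * l) 1 = m%:~R * s l 1.
Proof.
have G1 := dgroup1 HE.
have s0 : s 0 1 = 0 by have := scal_nat 0 0; rewrite !mul0r.
case: m => n; first exact: scal_nat.
rewrite !NegzE !rmorphN /= !mulNr; apply/eqP; rewrite -addr_eq0.
by rewrite -!pmulrn -scal_nat -(scalDl Hs) // addNr s0.
Qed.

Lemma scal_dyadic (m : int) n : s (m%:~R * 2^-1 ^+ n) 1 = m%:~R * c ^+ n.
Proof.
have G1 := dgroup1 HE.
rewrite scal_int; congr (_ * _).
elim: n => [|n IH]; first by rewrite !expr0 (scal1 Hs).
by rewrite !exprS -(scalA Hs) // IH scal_half // -IH; apply: (scal_closed Hs).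
Qed.

(* The scalar l is approximated by dyadic numbers, whose multiples of 1 are
   central in R. *)
Lemma scal1_comm x l : dgroup E x -> GRing.comm x (s l 1).
Proof.
move=> Gx; have G1 := dgroup1 HE.
have Gl : dgroup E (s l 1) by apply: (scal_closed Hs).
have sB a b : s (a - b) 1 = s a 1 - s b 1.
  by apply: (addIr (s b 1)); rewrite subrK -(scalDl Hs) // subrK.
have s_ge0 a : 0 <= a -> Eplus E (s a 1).
  move=> a0; have := scal_ge0 Hs G1 a0; rewrite /ele !subr0; apply.
  exact: Eplus1.
(* With this floor, [m / 2 ^ n <= l < (m + 1) / 2 ^ n]. *)
apply: comm_approx => // n; pose m := Num.floor (l * 2 ^+ n).
have m_le : m%:~R <= l * 2 ^+ n := floor_le _.
have m_gt : l * 2 ^+ n < m%:~R + 1 by rewrite -[1]/(1%:~R) -intrD floorD1_gt.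
have e2n : (2 : K)^-1 ^+ n * 2 ^+ n = 1 by rewrite -exprMn mulVf ?expr1n ?pnatr_eq0.
have e2 : 0 <= (2 : K)^-1 ^+ n by rewrite exprn_ge0 // invr_ge0 ler0n.
have lE : l = 2^-1 ^+ n * (l * 2 ^+ n) by rewrite mulrCA e2n mulr1.
have mC : GRing.comm x (m%:~R * c ^+ n).
  by apply: commrM; [apply: commr_int|apply/commrX/(half_central c2)].
exists (m%:~R * c ^+ n); split=> //; rewrite -?scal_dyadic.
- split=> [|a [_ /(_ _ erefl) al]]; first exact: (scal_closed Hs).
  rewrite scal_dyadic; apply/commr_sym.
  by apply: commrM; [apply: commr_int|apply/commrX/(half_central c2)].
- by rewrite -sB; apply: s_ge0; rewrite subr_ge0 [leRHS]lE mulrC ler_wpM2l //.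
- rewrite -[c ^+ n]mul1r -[1 * _]/(1%:~R * _) -scal_dyadic -(scalDl Hs) // -sB.
  apply: s_ge0; rewrite subr_ge0 -mulrDl [leLHS]lE mulrC ler_wpM2r //.
  exact: ltW.
Qed.

Lemma upper_proj_shift_bicommutant g l : dgroup E g ->
  bicommutant E [set g] (upper_proj (g - s l 1)).
Proof.
move=> Gg; apply: upper_proj_bicommutant; split.
  by apply: dgroupB => //; apply: (scal_closed Hs); apply: dgroup1.
move=> a [Ga /(_ _ erefl) ag]; apply/commr_sym.
by apply: commrB => //; apply: scal1_comm.
Qed.

(** Forwards, each projection lies in the bicommutant of its element, so commutation passes to one
    side and then the other. Backwards, [comm_upper_proj] is applied to [g] and then to [h], at
    dyadic thresholds. *)
Lemma comm_spectral_proj g h : dgroup E g -> dgroup E h ->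
  (GRing.comm g h <-> forall l m : K,
     GRing.comm (spectral_proj E s g l) (spectral_proj E s h m)).
Proof.
move=> Gg Gh.
have pg l : dgroup E (upper_proj (g - s l 1)) by case: (upper_proj_shift_bicommutant l Gg).
have ph l : dgroup E (upper_proj (h - s l 1)) by case: (upper_proj_shift_bicommutant l Gh).
split=> [gh l m|pp].
  rewrite !spectral_projE //; apply: commrB; first exact: commr1.
  apply/commr_sym/commrB; first exact: commr1.
  apply: bicommutant_comm (ph m) (upper_proj_shift_bicommutant l Gg) _.
  apply/commr_sym/(bicommutant_comm Gg (upper_proj_shift_bicommutant m Gh) gh).
have {}pp l m : GRing.comm (upper_proj (g - s l 1)) (upper_proj (h - s m 1)).
  have := pp l m; rewrite !spectral_projE // => pq.
  rewrite -[upper_proj (h - _)](subKr 1); apply: commrB; first exact: commr1.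
  apply/commr_sym; rewrite -[upper_proj (g - _)](subKr 1).
  by apply: commrB; [exact: commr1|exact/commr_sym].
apply/commr_sym/comm_upper_proj => // m n; rewrite -scal_dyadic.
apply/commr_sym/comm_upper_proj => // m' n'; rewrite -scal_dyadic.
exact: pp.
Qed.

End RealScalars.

(** For [y] commuting with [A], its upper projections lie in the bicommutant of [y], hence commute
    with [A]. An [x] commuting with all of them commutes with [y]. *)
Lemma commutant_projections (A : set R) : A `<=` dgroup E ->
  commutant E (commutant E A `&` projections E) = bicommutant E A.
Proof.
move=> GA; apply/seteqP; split; last by apply: sub_commutant => x [].
move=> x [Gx xC]; split=> // y [Gy yA]; apply: comm_upper_proj => // m n.
have fC : bicommutant E [set y] (y - m%:~R * c ^+ n).
  have HA := set1_commuting Gy.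
  have -> : y - m%:~R * c ^+ n = bicomm_val (bicomm_lift HE HA (bicommutant1 Gy)
      - m%:~R * bicomm_lift HE HA (bicommutant_half HE _ Ec c2) ^+ n).
    by rewrite rmorphB rmorphM rmorphXn rmorph_int.
  exact: bicomm_ringP.
have [Hp _ _ _ _] := upper_proj_spec (proj1 fC).
apply: xC; split=> //; split=> [|a Aa]; first by case: Hp.
apply/commr_sym; apply: bicommutant_comm (GA _ Aa) (upper_proj_bicommutant fC) _.
by apply/commr_sym/yA.
Qed.

End SpectralTheory.

Theorem corollary7p9 (R : nzRingType) (E : set R) (HE : is_AH_algebra E)
    (g h : R) (Gg : dgroup E g) (Gh : dgroup E h)
    (A : set R) (GA : A `<=` dgroup E) :
  [/\ forall (K : realType) (s : K -> R -> R), is_real_ordered_space E s ->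
        (GRing.comm g h <->
         forall l m : K,
           GRing.comm (spectral_proj E s g l) (spectral_proj E s h m)),
      commutant E (commutant E A `&` projections E) = bicommutant E A &
      CPC E g = bicommutant E [set g]].
Proof.
have [c Ec c2] := AH_half HE.
split=> [K s Hs| |].
- exact: (comm_spectral_proj HE Ec c2 Hs).
- exact: (commutant_projections HE Ec c2).
(* The third part is the second for [A = [set g]]. *)
- rewrite /CPC setIC; apply: (commutant_projections HE Ec c2).
  by move=> _ ->.
Qed.
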